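(* Let $M\in\mathbb{R}^{m\times n}_+$ be a nonnegative matrix. For $V\in\mathbb{R}^{m\times r}$, $W\in\mathbb{R}^{r\times n}$ with $V,W\ge\mathbf 0$, and with $R_k=M-\sum_{i\ne k}V_{:i}W_{i:}$, $\|M-VW\|_F$ is nonincreasing under $$\text{(a)}\quad V_{:k}\leftarrow V_{:k}\circ\frac{[(R_k)_+W_{k:}^T]}{[V_{:k}W_{k:}W_{k:}^T+(R_k)_-W_{k:}^T]},\qquad W_{k:}\leftarrow W_{k:}\circ\frac{[V_{:k}^T(R_k)_+]}{[V_{:k}^TV_{:k}W_{k:}+V_{:k}^T(R_k)_-]},\qquad\forall k.$$ Moreover, the updates (a) perform better than the updates $$\text{(b)}\quad V_{:k}\leftarrow V_{:k}\circ\frac{[MW_{k:}^T]}{[VWW_{k:}^T]},\qquad W_{k:}\leftarrow W_{k:}\circ\frac{[V_{:k}^TM]}{[V_{:k}^TVW]},$$ but worse than the updates $$\text{(c)}\quad V_{:k}\leftarrow\max\Big(\mathbf 0,\frac{R_kW_{k:}^T}{\|W_{k:}\|_2^2}\Big),\qquad W_{k:}\leftarrow\max\Big(\mathbf 0,\frac{V_{:k}^TR_k}{\|V_{:k}\|_2^2}\Big),$$ which are optimal. That is, starting from the same $(V,W)$ and updating the same single column $V_{:k}$ (respectively the same single row $W_{k:}$), the resulting value of $\|M-VW\|_F$ with (a) is at most the one with (b) and at least the one with (c), and (c) gives the minimum of $\|M-VW\|_F$ over all $V_{:k}\ge\mathbf 0$ (respectively $W_{k:}\ge\mathbf 0$)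 with all other variables fixed.
   Context: $V_{:k}$ is the $k$-th column of $V$ and $W_{k:}$ the $k$-th row of $W$. For a matrix $A$, $A_+=\max(\mathbf 0,A)$ and $A_-=\max(\mathbf 0,-A)$ entrywise, so $A=A_+-A_-$. $\circ$ is the component-wise product and $\frac{[A]}{[B]}$ is component-wise division (quotients being considered where denominators are nonzero). Inequalities and maxima are entrywise. Each update changes a single column of $V$ or a single row of $W$, all other entries being kept fixed. *)

(* Defs.v *)
From mathcomp Require Import all_boot all_order all_algebra.
From mathcomp Require Import reals.

Set Implicit Arguments.
Unset Strict Implicit.
Unset Printing Implicit Defensive.

Import Order.TTheory GRing.Theory Num.Theory.

Local Open Scope ring_scope.

Section Definitions.

Variable R : realType.

Definition nonneg_mx p q (A : 'M[R]_(p, q)) : Prop := forall i j, 0 <= A i j.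

(* On a single row or column this is the Euclidean norm. *)
Definition fnorm p q (A : 'M[R]_(p, q)) : R :=
  Num.sqrt (\sum_i \sum_j A i j ^+ 2).

Definition pospart p q (A : 'M[R]_(p, q)) : 'M[R]_(p, q) :=
  \matrix_(i, j) Num.max 0 (A i j).

Definition negpart p q (A : 'M[R]_(p, q)) : 'M[R]_(p, q) :=
  \matrix_(i, j) Num.max 0 (- A i j).

Definition set_col m r (k : 'I_r) (V : 'M[R]_(m, r)) (v : 'cV[R]_m) :
    'M[R]_(m, r) :=
  \matrix_(i, j) if j == k then v i 0 else V i j.

Definition set_row r n (k : 'I_r) (W : 'M[R]_(r, n)) (w : 'rV[R]_n) :
    'M[R]_(r, n) :=
  \matrix_(i, j) if i == k then w 0 j else W i j.

(* X o [A]/[B]: the quotient is only taken at the entries where B is nonzero,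
   the other entries of X are left unchanged. *)
Definition mul_quot p q (X A B : 'M[R]_(p, q)) : 'M[R]_(p, q) :=
  \matrix_(i, j) if B i j == 0 then X i j else X i j * (A i j / B i j).

Section Updates.

Variables (m n r : nat).
Variables (M : 'M[R]_(m, n)) (V : 'M[R]_(m, r)) (W : 'M[R]_(r, n)).
Variable (k : 'I_r).

Definition residual : 'M[R]_(m, n) :=
  M - \sum_(i < r | i != k) col i V *m row i W.

(* In the suffixes, rank1 refers to the multiplicative updates obtained from
   the residual, mu to the classical ones obtained from M, and opt to the
   exact coordinate minimization. *)
Definition col_rank1 : 'cV[R]_m :=
  mul_quot (col k V)
    (pospart residual *m (row k W)^T)
    (col k V *m row k W *m (row k W)^T + negpart residual *m (row k W)^T).

Definition row_rank1 : 'rV[R]_n :=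
  mul_quot (row k W)
    ((col k V)^T *m pospart residual)
    ((col k V)^T *m col k V *m row k W + (col k V)^T *m negpart residual).

Definition col_mu : 'cV[R]_m :=
  mul_quot (col k V) (M *m (row k W)^T) (V *m W *m (row k W)^T).

Definition row_mu : 'rV[R]_n :=
  mul_quot (row k W) ((col k V)^T *m M) ((col k V)^T *m V *m W).

(* As in mul_quot, nothing is changed when the denominator vanishes; the
   product V *m W then does not depend on the column (resp. row) at hand. *)
Definition col_opt : 'cV[R]_m :=
  if fnorm (row k W) ^+ 2 == 0 then col k V
  else pospart ((fnorm (row k W) ^+ 2)^-1 *: (residual *m (row k W)^T)).

Definition row_opt : 'rV[R]_n :=
  if fnorm (col k V) ^+ 2 == 0 then row k W
  else pospart ((fnorm (col k V) ^+ 2)^-1 *: ((col k V)^T *m residual)).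

End Updates.

End Definitions.

(* Main.v *)
(** With the residual [R] and the row [w] of [W] fixed, the squared error is
    [sum_i (s v_i^2 - 2 b_i v_i)] up to a constant, where [s = |w|^2] and
    [b = R w^T]: the coordinates decouple into one-variable convex quadratics.
    Each multiplicative update is a step [x + t (b - x s)], which changes the
    quadratic by [(s t^2 - 2 t) (b - x s)^2], a nonincreasing function of [t]
    as long as [s t <= 1]. Since [0 <= R_- <= sum_(i != k) V_i W_i], the step
    sizes satisfy [0 <= t_mu <= t_rank1 <= 1 / s]. The row updates are the
    column updates of the transposed problem. *)

Require Import Defs.
From mathcomp Require Import all_boot all_order all_algebra.
From mathcomp Require Import reals.
From mathcomp Require Import ring lra.

Set Implicit Arguments.
Unset Strict Implicit.

Import Order.TTheory GRing.Theory Num.Theory.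
Local Open Scope ring_scope.

(** * One-variable quadratics and step sizes *)

Definition quad (F : realFieldType) (s b y : F) : F := s * y ^+ 2 - 2 * b * y.

Lemma quad_step (F : realFieldType) (s b x t : F) :
  quad s b (x + t * (b - x * s)) =
  quad s b x + (s * t ^+ 2 - 2 * t) * (b - x * s) ^+ 2.
Proof. by rewrite /quad; ring. Qed.

Lemma quad_step_le (F : realFieldType) (s b x t u : F) :
  0 <= s -> u <= t -> s * t <= 1 ->
  quad s b (x + t * (b - x * s)) <= quad s b (x + u * (b - x * s)).
Proof.
move=> s0 ut st; rewrite !quad_step lerD2l ler_wpM2r ?sqr_ge0//.
have su : s * u <= s * t by rewrite ler_wpM2l.
(* The difference is [(t - u) * (2 - s * t - s * u)], where [s * t] and [s * u] are at most 1. *)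
by rewrite -subr_ge0; nra.
Qed.

(* The convention [x / 0 = 0] makes the vanishing denominator a zero step. *)
Lemma mul_quot_step (F : realFieldType) (s x p q : F) :
  (if x * s + q == 0 then x else x * (p / (x * s + q))) =
  x + x / (x * s + q) * (p - q - x * s).
Proof.
have [->|D0] := eqVneq; first by rewrite invr0 mulr0 mul0r addr0.
by field.
Qed.

Lemma step_size_le (F : realFieldType) (s x q : F) :
  0 <= s -> 0 <= x -> 0 <= q -> s * (x / (x * s + q)) <= 1.
Proof.
move=> s0 x0 q0; have D0 : 0 <= x * s + q by rewrite addr_ge0 ?mulr_ge0.
have [->|D1] := eqVneq (x * s + q) 0; first by rewrite invr0 !mulr0 ler01.
by rewrite mulrA ler_pdivrMr ?lt_def ?D1// mul1r mulrC lerDl.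
Qed.

(* If [x * s = 0], the left denominator may vanish while the right one does
   not, so the step sizes need not compare; but then either no step is taken
   or the quadratic is zero. *)
Lemma quad_mul_step_le_mul_step (F : realFieldType) (s b x q d : F) :
  (s = 0 -> b = 0) -> 0 <= s -> 0 <= x -> 0 <= q -> 0 <= d ->
  quad s b (x + x / (x * s + q) * (b - x * s)) <=
  quad s b (x + x / (x * s + (q + d)) * (b - x * s)).
Proof.
move=> sb s0 x0 q0 d0.
have [s00|s1] := eqVneq s 0; first
  by rewrite /quad (sb s00) s00 !mul0r !mulr0 !mul0r.
have [->|x1] := eqVneq x 0; first by rewrite !mul0r.
have D0 : 0 < x * s + q by rewrite ltr_wpDr// mulr_gt0// lt_def ?x1 ?s1.
apply: quad_step_le => //; last exact: step_size_le.
by rewrite ler_wpM2l// lef_pV2 ?posrE ?addrA ?lerDl// ltr_wpDr.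
Qed.

Lemma quad_mul_step_le (F : realFieldType) (s b x q : F) :
  0 <= s -> 0 <= x -> 0 <= q ->
  quad s b (x + x / (x * s + q) * (b - x * s)) <= quad s b x.
Proof.
move=> s0 x0 q0.
(* The current point is the step of size 0, so step sizes can be compared. *)
rewrite -[leRHS](_ : quad s b (x + 0 * (b - x * s)) = _); last first.
  by rewrite mul0r addr0.
apply: quad_step_le => //; last exact: step_size_le.
by rewrite divr_ge0// addr_ge0// mulr_ge0.
Qed.

(** Completing the square turns the minimization over [y >= 0] into the projection of [s^-1 * b]
    onto the half-line. *)
Lemma quad_opt_le (F : realFieldType) (s b y : F) :
  0 < s -> 0 <= y -> quad s b (Num.max 0 (s^-1 * b)) <= quad s b y.
Proof.
move=> s0 y0.
have squareE z : quad s b z = s * (z - s^-1 * b) ^+ 2 - s^-1 * b ^+ 2.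
  by rewrite /quad; field; rewrite gt_eqF.
rewrite !squareE lerD2r ler_wpM2l ?(ltW s0)//.
case: (leP 0 (s^-1 * b)) => [_|c0]; first by rewrite subrr expr0n /= sqr_ge0.
by rewrite ler_sqr ?nnegrE; lra.
Qed.

(** * Signs, Frobenius norms and reduction to coordinates *)

Lemma posnegpart (R : realType) p q (A : 'M[R]_(p, q)) :
  pospart A - negpart A = A.
Proof.
by apply/matrixP => i j; rewrite !mxE; case: (leP 0 (A i j)); case: (leP 0 (- A i j)); lra.
Qed.

Lemma pospart_ge0 (R : realType) p q (A : 'M[R]_(p, q)) : nonneg_mx (pospart A).
Proof. by move=> i j; rewrite mxE le_max lexx. Qed.

Lemma negpart_ge0 (R : realType) p q (A : 'M[R]_(p, q)) : nonneg_mx (negpart A).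
Proof. by move=> i j; rewrite mxE le_max lexx. Qed.

Lemma mulmx_ge0 (R : realType) p q l (A : 'M[R]_(p, q)) (B : 'M[R]_(q, l)) :
  nonneg_mx A -> nonneg_mx B -> nonneg_mx (A *m B).
Proof. by move=> A0 B0 i j; rewrite mxE sumr_ge0// => a _; rewrite mulr_ge0. Qed.

Lemma mul_quot_ge0 (R : realType) p q (X A B : 'M[R]_(p, q)) :
  nonneg_mx X -> nonneg_mx A -> nonneg_mx B -> nonneg_mx (mul_quot X A B).
Proof.
by move=> X0 A0 B0 i j; rewrite mxE; case: ifP => // _; rewrite mulr_ge0 ?divr_ge0.
Qed.

Lemma fnorm_sqr (R : realType) p q (A : 'M[R]_(p, q)) :
  fnorm A ^+ 2 = \sum_i \sum_j A i j ^+ 2.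
Proof.
by rewrite sqr_sqrtr// sumr_ge0// => i _; rewrite sumr_ge0// => j _; rewrite sqr_ge0.
Qed.

Lemma fnorm_row_sqr (R : realType) q (w : 'rV[R]_q) :
  fnorm w ^+ 2 = (w *m w^T) 0 0.
Proof.
by rewrite fnorm_sqr big_ord1 mxE; apply: eq_bigr => j _; rewrite mxE expr2.
Qed.

Lemma fnorm_row_sqr_eq0 (R : realType) q (w : 'rV[R]_q) :
  fnorm w ^+ 2 = 0 -> w = 0.
Proof.
rewrite fnorm_sqr big_ord1 => /eqP; rewrite psumr_eq0; last by move=> j _; exact: sqr_ge0.
move=> /allP w0; apply/rowP => j; rewrite mxE.
by have := w0 j (mem_index_enum j); rewrite sqrf_eq0 => /eqP.
Qed.

Lemma fnorm_tr (R : realType) p q (A : 'M[R]_(p, q)) : fnorm A^T = fnorm A.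
Proof.
rewrite /fnorm exchange_big; congr Num.sqrt.
by apply: eq_bigr => i _; apply: eq_bigr => j _; rewrite mxE.
Qed.

(** Row [i] of [A - z *m w] involves only the entry [z i 0], so the squared error is a sum of
    independent quadratics plus a constant. *)
Lemma fnorm_rank1_le (R : realType) m n (A : 'M[R]_(m, n)) (w : 'rV[R]_n)
    (u v : 'cV[R]_m) :
  (forall i, quad (fnorm w ^+ 2) ((A *m w^T) i 0) (u i 0) <=
             quad (fnorm w ^+ 2) ((A *m w^T) i 0) (v i 0)) ->
  fnorm (A - u *m w) <= fnorm (A - v *m w).
Proof.
move=> quv; rewrite ler_wsqrtr//; apply: ler_sum => i _.
have expand (z : 'cV[R]_m) : \sum_j (A - z *m w) i j ^+ 2 =
    \sum_j A i j ^+ 2 + quad (fnorm w ^+ 2) ((A *m w^T) i 0) (z i 0).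
  rewrite /quad fnorm_row_sqr [(_ *m w^T) 0 0]mxE [(_ *m w^T) i 0]mxE.
  rewrite mulr_sumr !mulr_suml -sumrB -big_split /=.
  by apply: eq_bigr => j _; rewrite !mxE big_ord1; ring.
by rewrite !expand lerD2l.
Qed.

(** The residual does not see column [k], hence all candidate columns are compared against the same
    matrix. *)
Lemma sub_mul_set_col (R : realType) m n r (M : 'M[R]_(m, n))
    (V : 'M[R]_(m, r)) (W : 'M[R]_(r, n)) (k : 'I_r) (v : 'cV[R]_m) :
  M - set_col k V v *m W = residual M V W k - v *m row k W.
Proof.
apply/matrixP => i j; rewrite !mxE summxE big_ord1 (bigD1 k)//= !mxE eqxx.
rewrite opprD addrA addrAC; congr (_ - _ - _).
by apply: eq_bigr => l lk; rewrite !mxE (negPf lk) big_ord1 !mxE.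
Qed.

Lemma set_col_col (R : realType) m r (V : 'M[R]_(m, r)) (k : 'I_r) :
  set_col k V (col k V) = V.
Proof. by apply/matrixP => i j; rewrite !mxE; case: eqP => // ->. Qed.

Lemma row_ge0 (R : realType) p q (A : 'M[R]_(p, q)) (k : 'I_p) :
  nonneg_mx A -> nonneg_mx (row k A).
Proof. by move=> A0 i j; rewrite mxE. Qed.

Lemma col_ge0 (R : realType) p q (A : 'M[R]_(p, q)) (k : 'I_q) :
  nonneg_mx A -> nonneg_mx (col k A).
Proof. by move=> A0 i j; rewrite mxE. Qed.

Lemma tr_ge0 (R : realType) p q (A : 'M[R]_(p, q)) :
  nonneg_mx A -> nonneg_mx A^T.
Proof. by move=> A0 i j; rewrite mxE. Qed.

(** * Column updates as steps of explicit size *)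

Lemma mul_row_col_scalar (R : realType) m n (v : 'cV[R]_m) (w : 'rV[R]_n) i :
  (v *m w *m w^T) i 0 = v i 0 * fnorm w ^+ 2.
Proof. by rewrite -mulmxA mxE big_ord1 fnorm_row_sqr. Qed.

Lemma mulmxBl_entry (R : realType) p q l (A B : 'M[R]_(p, q))
    (C : 'M[R]_(q, l)) i j :
  ((A - B) *m C) i j = (A *m C) i j - (B *m C) i j.
Proof. by rewrite mulmxBl !mxE. Qed.

(** This is [mul_quot_step] with [p] and [q] coming from the positive and negative parts of the
    residual, so that [p - q] comes from the residual itself. *)
Lemma col_rank1_step (R : realType) m n r (M : 'M[R]_(m, n))
    (V : 'M[R]_(m, r)) (W : 'M[R]_(r, n)) (k : 'I_r) i :
  let w := row k W in let A := residual M V W k in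
  let s := fnorm w ^+ 2 in
  col_rank1 M V W k i 0 = V i k + V i k / (V i k * s + (negpart A *m w^T) i 0)
    * ((A *m w^T) i 0 - V i k * s).
Proof.
move=> w A s; have colE : col k V i 0 = V i k by rewrite mxE.
rewrite mxE [(_ + _ *m _) i 0]mxE mul_row_col_scalar colE mul_quot_step.
by rewrite -[X in (X *m w^T) i 0 - _](posnegpart A) mulmxBl_entry.
Qed.

(** The denominator is split so that its excess over that of [col_rank1_step], the term in
    [M - pospart A], is visible. *)
Lemma col_mu_step (R : realType) m n r (M : 'M[R]_(m, n))
    (V : 'M[R]_(m, r)) (W : 'M[R]_(r, n)) (k : 'I_r) i :
  let w := row k W in let A := residual M V W k in
  let s := fnorm w ^+ 2 in
  col_mu M V W k i 0 = V i k + V i k / (V i k * s +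
    ((negpart A *m w^T) i 0 + ((M - pospart A) *m w^T) i 0))
    * ((A *m w^T) i 0 - V i k * s).
Proof.
move=> w A s; have colE : col k V i 0 = V i k by rewrite mxE.
(* This is [sub_mul_set_col] with column [k] replaced by itself. *)
have mulVW : V *m W = M - A + col k V *m w.
  by rewrite -[X in X *m W](set_col_col V k) -[LHS](subKr M) sub_mul_set_col
    opprB addrA addrAC addrC addrA.
have -> : (negpart A *m w^T) i 0 + ((M - pospart A) *m w^T) i 0 =
          ((M - A) *m w^T) i 0.
  rewrite -[X in _ = ((_ - X) *m _) i 0](posnegpart A) opprB addrCA.
  by rewrite (mulmxDl (negpart A)) [RHS]mxE.
have -> : (A *m w^T) i 0 = (M *m w^T) i 0 - ((M - A) *m w^T) i 0.
  by rewrite mulmxBl_entry subKr.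
have denE : (V *m W *m w^T) i 0 = V i k * s + ((M - A) *m w^T) i 0.
  by rewrite mulVW mulmxDl mxE mul_row_col_scalar colE addrC.
by rewrite mxE -/w denE colE mul_quot_step.
Qed.

(** Both arguments of the maximum are at most [M]: zero since [M] is nonnegative, the residual since
    it subtracts nonnegative products from [M]. *)
Lemma pospart_residual_le (R : realType) m n r (M : 'M[R]_(m, n))
    (V : 'M[R]_(m, r)) (W : 'M[R]_(r, n)) (k : 'I_r) :
  nonneg_mx M -> nonneg_mx V -> nonneg_mx W ->
  nonneg_mx (M - pospart (residual M V W k)).
Proof.
move=> M0 V0 W0 i j; rewrite !mxE subr_ge0 ge_max M0 gerBl summxE.
rewrite sumr_ge0// => l _.
by rewrite mulmx_ge0//; [exact: col_ge0|exact: row_ge0].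
Qed.

(** Makes update (a) an admissible competitor for the optimal update (c). *)
Lemma col_rank1_ge0 (R : realType) m n r (M : 'M[R]_(m, n))
    (V : 'M[R]_(m, r)) (W : 'M[R]_(r, n)) (k : 'I_r) :
  nonneg_mx V -> nonneg_mx W -> nonneg_mx (col_rank1 M V W k).
Proof.
move=> V0 W0; have w0 := tr_ge0 (row_ge0 k W0); have v0 := col_ge0 k V0.
apply: mul_quot_ge0 => //; first exact/mulmx_ge0/w0/pospart_ge0.
move=> i j; rewrite mxE addr_ge0//; first exact/mulmx_ge0/w0/mulmx_ge0/row_ge0.
exact/mulmx_ge0/w0/negpart_ge0.
Qed.

Lemma col_opt_ge0 (R : realType) m n r (M : 'M[R]_(m, n))
    (V : 'M[R]_(m, r)) (W : 'M[R]_(r, n)) (k : 'I_r) :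
  nonneg_mx V -> nonneg_mx (col_opt M V W k).
Proof.
by move=> V0; rewrite /col_opt; case: ifP => _; [exact: col_ge0|exact: pospart_ge0].
Qed.

(** * Comparison of the column updates *)

Lemma fnorm_col_rank1_le (R : realType) m n r (M : 'M[R]_(m, n))
    (V : 'M[R]_(m, r)) (W : 'M[R]_(r, n)) (k : 'I_r) :
  nonneg_mx V -> nonneg_mx W ->
  fnorm (M - set_col k V (col_rank1 M V W k) *m W) <= fnorm (M - V *m W).
Proof.
move=> V0 W0; rewrite -[X in _ <= fnorm (_ - X *m _)](set_col_col V k).
rewrite !sub_mul_set_col; apply: fnorm_rank1_le => i.
rewrite col_rank1_step [col k V i 0]mxE quad_mul_step_le ?sqr_ge0//.
exact/mulmx_ge0/tr_ge0/row_ge0/W0/negpart_ge0.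
Qed.

Lemma fnorm_col_rank1_le_col_mu (R : realType) m n r (M : 'M[R]_(m, n))
    (V : 'M[R]_(m, r)) (W : 'M[R]_(r, n)) (k : 'I_r) :
  nonneg_mx M -> nonneg_mx V -> nonneg_mx W ->
  fnorm (M - set_col k V (col_rank1 M V W k) *m W) <=
  fnorm (M - set_col k V (col_mu M V W k) *m W).
Proof.
move=> M0 V0 W0; have w0 := tr_ge0 (row_ge0 k W0).
rewrite !sub_mul_set_col; apply: fnorm_rank1_le => i.
rewrite col_rank1_step col_mu_step quad_mul_step_le_mul_step ?sqr_ge0//.
(* If [s = 0], the row vanishes, and with it the linear coefficient. *)
- by move=> /fnorm_row_sqr_eq0 ->; rewrite trmx0 mulmx0 mxE.
- exact/mulmx_ge0/w0/negpart_ge0.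
- exact/mulmx_ge0/w0/pospart_residual_le.
Qed.

Lemma fnorm_col_opt_le (R : realType) m n r (M : 'M[R]_(m, n))
    (V : 'M[R]_(m, r)) (W : 'M[R]_(r, n)) (k : 'I_r) (v : 'cV[R]_m) :
  nonneg_mx v ->
  fnorm (M - set_col k V (col_opt M V W k) *m W) <=
  fnorm (M - set_col k V v *m W).
Proof.
move=> v0; rewrite !sub_mul_set_col /col_opt.
(* For a zero row both errors equal the norm of the residual. *)
have [/fnorm_row_sqr_eq0 ->|s1] := eqVneq; first by rewrite !mulmx0.
apply: fnorm_rank1_le => i; rewrite [pospart _ _ _]mxE [X in Num.max _ X]mxE.
by rewrite quad_opt_le// lt_def s1 sqr_ge0.
Qed.

(** * Row updates by transposition *)

Lemma trmx_set_row (R : realType) r n (k : 'I_r) (W : 'M[R]_(r, n))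
    (w : 'rV[R]_n) : (set_row k W w)^T = set_col k W^T w^T.
Proof. by apply/matrixP => i j; rewrite !mxE. Qed.

Lemma trmx_mul_quot (R : realType) p q (X A B : 'M[R]_(p, q)) :
  (mul_quot X A B)^T = mul_quot X^T A^T B^T.
Proof. by apply/matrixP => i j; rewrite !mxE. Qed.

Lemma trmx_pospart (R : realType) p q (A : 'M[R]_(p, q)) :
  (pospart A)^T = pospart A^T.
Proof. by apply/matrixP => i j; rewrite !mxE. Qed.

Lemma trmx_negpart (R : realType) p q (A : 'M[R]_(p, q)) :
  (negpart A)^T = negpart A^T.
Proof. by apply/matrixP => i j; rewrite !mxE. Qed.

Lemma trmx_residual (R : realType) m n r (M : 'M[R]_(m, n))
    (V : 'M[R]_(m, r)) (W : 'M[R]_(r, n)) (k : 'I_r) :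
  (residual M V W k)^T = residual M^T W^T V^T k.
Proof.
rewrite /residual linearB linear_sum /=; congr (_ - _).
by apply: eq_bigr => i _; rewrite trmx_mul tr_col tr_row.
Qed.

Lemma trmx_row_rank1 (R : realType) m n r (M : 'M[R]_(m, n))
    (V : 'M[R]_(m, r)) (W : 'M[R]_(r, n)) (k : 'I_r) :
  (row_rank1 M V W k)^T = col_rank1 M^T W^T V^T k.
Proof.
rewrite trmx_mul_quot linearD /= !trmx_mul trmxK trmx_pospart trmx_negpart.
by rewrite trmx_residual tr_row mulmxA /col_rank1 -tr_col trmxK.
Qed.

Lemma trmx_row_mu (R : realType) m n r (M : 'M[R]_(m, n))
    (V : 'M[R]_(m, r)) (W : 'M[R]_(r, n)) (k : 'I_r) :
  (row_mu M V W k)^T = col_mu M^T W^T V^T k.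
Proof.
by rewrite trmx_mul_quot !trmx_mul trmxK tr_row mulmxA /col_mu -tr_col trmxK.
Qed.

Lemma trmx_row_opt (R : realType) m n r (M : 'M[R]_(m, n))
    (V : 'M[R]_(m, r)) (W : 'M[R]_(r, n)) (k : 'I_r) :
  (row_opt M V W k)^T = col_opt M^T W^T V^T k.
Proof.
rewrite /row_opt /col_opt -tr_col fnorm_tr; case: ifP => _; first exact: tr_row.
by rewrite trmx_pospart linearZ /= trmx_mul trmx_residual.
Qed.

(** Transposition keeps the norm and exchanges the factors, so [W^T] becomes the left factor,
    updated by columns. *)
Lemma fnorm_sub_mul_set_row (R : realType) m n r (M : 'M[R]_(m, n))
    (V : 'M[R]_(m, r)) (W : 'M[R]_(r, n)) (k : 'I_r) (w : 'rV[R]_n) :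
  fnorm (M - V *m set_row k W w) = fnorm (M^T - set_col k W^T w^T *m V^T).
Proof. by rewrite -fnorm_tr linearB /= trmx_mul trmx_set_row. Qed.

Unset Implicit Arguments.

Theorem corollary3 (R : realType) (m n r : nat) (M : 'M[R]_(m, n))
    (V : 'M[R]_(m, r)) (W : 'M[R]_(r, n)) (k : 'I_r)
    (hM : nonneg_mx M) (hV : nonneg_mx V) (hW : nonneg_mx W) :
  let Va := set_col k V (col_rank1 M V W k) in
  let Vb := set_col k V (col_mu M V W k) in
  let Vc := set_col k V (col_opt M V W k) in
  let Wa := set_row k W (row_rank1 M V W k) in
  let Wb := set_row k W (row_mu M V W k) in
  let Wc := set_row k W (row_opt M V W k) in
  (* the error is nonincreasing under the rank1 updates (a) *)
  (fnorm (M - Va *m W) <= fnorm (M - V *m W) /\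
   fnorm (M - V *m Wa) <= fnorm (M - V *m W)) /\
  (* (a) performs better than the mu updates (b) *)
  (fnorm (M - Va *m W) <= fnorm (M - Vb *m W) /\
   fnorm (M - V *m Wa) <= fnorm (M - V *m Wb)) /\
  (* (a) performs worse than the opt updates (c) *)
  (fnorm (M - Vc *m W) <= fnorm (M - Va *m W) /\
   fnorm (M - V *m Wc) <= fnorm (M - V *m Wa)) /\
  (* (c) is optimal *)
  (nonneg_mx (col_opt M V W k) /\
   (forall v : 'cV[R]_m, nonneg_mx v ->
      fnorm (M - Vc *m W) <= fnorm (M - set_col k V v *m W))) /\
  (nonneg_mx (row_opt M V W k) /\
   (forall w : 'rV[R]_n, nonneg_mx w ->
      fnorm (M - V *m Wc) <= fnorm (M - V *m set_row k W w))).
Proof.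
move=> Va Vb Vc Wa Wb Wc.
have hMT := tr_ge0 hM; have hVT := tr_ge0 hV; have hWT := tr_ge0 hW.
rewrite /Wa /Wb /Wc !fnorm_sub_mul_set_row trmx_row_rank1 trmx_row_mu.
rewrite trmx_row_opt; split; first split.
- exact: fnorm_col_rank1_le.
(* The right-hand side contains no [set_row] and has to be transposed separately. *)
- rewrite -[leRHS]fnorm_tr linearB /= trmx_mul; exact: fnorm_col_rank1_le.
split; first by split; exact: fnorm_col_rank1_le_col_mu.
split; first by split; apply: fnorm_col_opt_le; exact: col_rank1_ge0.
split; first by split; [exact: col_opt_ge0|move=> v; exact: fnorm_col_opt_le].
split; first by rewrite -[row_opt _ _ _ _]trmxK trmx_row_opt; exact/tr_ge0/col_opt_ge0.
move=> w w0; rewrite !fnorm_sub_mul_set_row; exact/fnorm_col_opt_le/tr_ge0.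
Qed.
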